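(* Let $k\ge 2$ and let $Q_k$ be the tree obtained from two disjoint copies of the star $K_{1,k-1}$ by identifying a leaf of one copy with a leaf of the other copy. Then $Q_k$ is $k$-$cfc$-critical.
   Context: For an edge-colored graph, a path is conflict-free if some color occurs on exactly one of its edges; $cfc(G)$ is the minimum number of colors in an edge-coloring of the connected graph $G$ in which every pair of distinct vertices is joined by a conflict-free path. A nontrivial tree $T$ is $cfc$-critical if for every edge $e$ of $T$, every nontrivial component $T'$ of $T-e$ satisfies $cfc(T')<cfc(T)$; it is $k$-$cfc$-critical if in addition $cfc(T)=k$. *)

(* Defs.v *)
From mathcomp Require Import all_boot.

Set Implicit Arguments.
Unset Strict Implicit.
Unset Printing Implicit Defensive.

Record sgraph := SGraph {
  vertex :> finType;
  adj : rel vertex;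
  adj_sym : symmetric adj;
  adj_irr : irreflexive adj }.

Arguments adj {s} : rename.

Definition edges (G : sgraph) : {set {set G}} :=
  [set [set u.1; u.2] | u : G * G & adj u.1 u.2].

Definition edge (G : sgraph) : finType := {e : {set G} | e \in edges G}.

Definition connected (G : sgraph) : bool :=
  (0 < #|G|) && [forall x : G, forall y : G, connect adj x y].

Definition acyclic (G : sgraph) : Prop :=
  forall s : seq G, ucycle adj s -> size s <= 2.

Definition is_tree (G : sgraph) : Prop := connected G /\ acyclic G.

Definition leaf (G : sgraph) (x : G) : bool := #|[set y : G | adj x y]| == 1.

(* Vertices listed as [x :: p], hence no repeated vertex. *)
Definition is_path (G : sgraph) (x y : G) (p : seq G) : bool :=
  [&& path adj x p, last x p == y & uniq (x :: p)].

Definition path_edges (G : sgraph) (x : G) (p : seq G) : seq {set G} :=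
  pairmap (fun u v => [set u; v]) x p.

Definition coloring (G : sgraph) (k : nat) : finType := {ffun edge G -> 'I_k}.

Definition conflict_free (G : sgraph) (k : nat) (c : coloring G k)
    (x : G) (p : seq G) : bool :=
  [exists i : 'I_k,
    #|[set e : edge G | (val e \in path_edges x p) && (c e == i)]| == 1].

(* The length bound on [p] makes the quantification finite and loses nothing,
   paths being duplicate-free: see [cf_linkedP]. *)
Definition cf_linked (G : sgraph) (k : nat) (c : coloring G k) (x y : G) : bool :=
  [exists p : #|G|.-bseq G, is_path x y p && conflict_free c x p].

Lemma cf_linkedP (G : sgraph) (k : nat) (c : coloring G k) (x y : G) :
  reflect (exists p : seq G, is_path x y p /\ conflict_free c x p)
          (cf_linked c x y).
Proof.
apply: (iffP existsP) => [[p /andP[xpy cfp]]|[p [xpy cfp]]]; first by exists p.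
have sz_p : size p <= #|G|.
  case/and3P: (xpy) => _ _ /card_uniqP card_p.
  by apply: leq_trans (max_card [in x :: p]); rewrite card_p /= leqnSn.
by exists (Bseq sz_p); rewrite xpy.
Qed.

Definition cf_colorable (G : sgraph) (k : nat) : bool :=
  [exists c : coloring G k,
    [forall x : G, forall y : G, (x != y) ==> cf_linked c x y]].

Lemma cfc_exists (G : sgraph) : exists k, connected G ==> cf_colorable G k.
Proof.
exists #|edge G|; apply/implyP => /andP[_ /forallP Gconn].
apply/existsP; exists [ffun e => enum_rank e].
apply/forallP => x; apply/forallP => y; apply/implyP => neq_xy.
have /forallP/(_ y)/connectP[p0 p0P def_y] := Gconn x.
case/shortenP: p0P def_y => p xp uniq_p _ def_y.
apply/cf_linkedP; exists p; split; first by rewrite /is_path xp uniq_p def_y eqxx.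
case: p xp {uniq_p} def_y => [|z p] /= => [_ def_y|/andP[xz _] _].
  by rewrite def_y eqxx in neq_xy.
have eP : [set x; z] \in edges G by apply/imsetP; exists (x, z); rewrite ?inE.
pose e : edge G := exist (fun e => e \in edges G) _ eP.
apply/existsP; exists (enum_rank e); apply/cards1P; exists e.
apply/setP => e'; rewrite !inE ffunE (inj_eq enum_rank_inj) andbC.
by case: (eqVneq e' e) => [->|]; rewrite //= ?inE eqxx.
Qed.

(* Meaningful for connected [G] only (it is 0 otherwise). *)
Definition cfc (G : sgraph) : nat := ex_minn (cfc_exists G).

Section DelEdge.
Variables (G : sgraph) (e : {set G}).

Definition del_edge_adj : rel G := fun x y => adj x y && ([set x; y] != e).

Lemma del_edge_sym : symmetric del_edge_adj.
Proof. by move=> x y; rewrite /del_edge_adj adj_sym setUC. Qed.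

Lemma del_edge_irr : irreflexive del_edge_adj.
Proof. by move=> x; rewrite /del_edge_adj adj_irr. Qed.

Definition del_edge : sgraph := SGraph del_edge_sym del_edge_irr.
End DelEdge.

Section Induced.
Variables (G : sgraph) (S : {set G}).

Definition induced_adj : rel {x : G | x \in S} :=
  fun x y => adj (val x) (val y).

Lemma induced_sym : symmetric induced_adj.
Proof. by move=> x y; rewrite /induced_adj adj_sym. Qed.

Lemma induced_irr : irreflexive induced_adj.
Proof. by move=> x; rewrite /induced_adj adj_irr. Qed.

Definition induced : sgraph := SGraph induced_sym induced_irr.
End Induced.

Definition components (G : sgraph) : {set {set G}} :=
  equivalence_partition (connect (@adj G)) [set: G].

Definition cfc_critical (T : sgraph) : Prop :=
  [/\ is_tree T, 1 < #|T| &
      forall e : {set T}, e \in edges T ->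
      forall C : {set del_edge e}, C \in components (del_edge e) ->
      1 < #|C| -> cfc (@induced (del_edge e) C) < cfc T].

Definition k_cfc_critical (k : nat) (T : sgraph) : Prop :=
  cfc_critical T /\ cfc T = k.

Section Star.
Variable n : nat.

(* The star K_{1,n}, with centre [None]. *)
Definition star_adj : rel (option 'I_n) := fun x y => isSome x != isSome y.

Lemma star_sym : symmetric star_adj.
Proof. by move=> x y; rewrite /star_adj eq_sym. Qed.

Lemma star_irr : irreflexive star_adj.
Proof. by move=> x; rewrite /star_adj eqxx. Qed.

Definition star : sgraph := SGraph star_sym star_irr.
End Star.

(* Disjoint union of [G] and [H] with [a : G] and [b : H] identified; the
   merged vertex is [inl a], so [b] is left out of the second summand. *)
Section Glue.
Variables (G H : sgraph) (a : G) (b : H).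

Definition glue_adj : rel (G + {y : H | y != b}) := fun u v =>
  match u, v with
  | inl x, inl y => adj x y
  | inr x, inr y => adj (val x) (val y)
  | inl x, inr y | inr y, inl x => (x == a) && adj b (val y)
  end.

Lemma glue_sym : symmetric glue_adj.
Proof. by case=> x [] y //=; rewrite adj_sym. Qed.

Lemma glue_irr : irreflexive glue_adj.
Proof. by case=> x /=; rewrite adj_irr. Qed.

Definition glue : sgraph := SGraph glue_sym glue_irr.
End Glue.

(* Main.v *)
(** Let [u], [v] be the centres of the two stars and [w] the shared leaf.  Every
    path of length at least 3 in [Q_k] runs through [u], [w], [v], so a proper
    edge coloring in which the edge [wv] has a color of its own is
    conflict-free.  This costs [k] colors on [Q_k], and [k-1] once an edge of
    the star at [u] is deleted; if the edge is at [v], swap the two centres.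
    Conversely, in a conflict-free coloring two edges sharing a vertex differ
    in color, so with only [k-1] colors both stars use all of them; picking [x]
    with [c(ux) = c(vw)] and [y] with [c(vy) = c(uw)], the unique path
    [x u w v y] shows each of its two colors twice. *)
Require Import Defs.
From mathcomp Require Import all_boot.

Set Implicit Arguments.
Unset Strict Implicit.
Unset Printing Implicit Defensive.

(** * Edges, incidence and conflict-free paths *)

Section Edges.
Variable G : sgraph.

Lemma adj_edge (x y : G) : adj x y -> [set x; y] \in edges G.
Proof. by move=> xy; apply/imsetP; exists (x, y); rewrite ?inE. Qed.

Lemma edgesP (e : {set G}) :
  reflect (exists x y, adj x y /\ e = [set x; y]) (e \in edges G).
Proof.
apply: (iffP imsetP) => [[[x y]]|[x [y [xy ->]]]].
  by rewrite inE => /= xy ->; exists x, y.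
by exists (x, y); rewrite ?inE.
Qed.

Lemma path_edges_sub (x : G) (p : seq G) :
  path adj x p -> {subset path_edges x p <= edges G}.
Proof.
elim: p x => //= y p IHp x /andP[xy yp] e; rewrite inE => /predU1P[->|].
  exact: adj_edge.
exact: IHp.
Qed.

Lemma set2_injr (x y z : G) : [set x; y] = [set x; z] -> y = z.
Proof.
move=> /setP eq_yz; have := eq_yz y; have := eq_yz z.
by rewrite !inE !eqxx !orbT; case: eqVneq => [->|_] /=; case: eqVneq => [->|_].
Qed.

Definition incident (x : G) : {set {set G}} := [set e in edges G | x \in e].

Lemma incidentE (x : G) :
  incident x = [set [set x; y] | y in [set y | adj x y]].
Proof.
apply/setP => e; rewrite inE; apply/andP/imsetP => [[/edgesP[y [z [yz ->]]]]|].
  rewrite !inE => /orP[] /eqP->; first by exists z; rewrite ?inE.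
  by exists y; rewrite ?inE 1?adj_sym // setUC.
by case=> y; rewrite inE => xy ->; rewrite adj_edge // !inE eqxx.
Qed.

Lemma card_incident (x : G) : #|incident x| = #|[set y | adj x y]|.
Proof. by rewrite incidentE card_imset // => y z; apply: set2_injr. Qed.

Lemma conflict_freeP (k : nat) (c : coloring G k) (x : G) (p : seq G) :
  reflect (exists2 e : edge G, val e \in path_edges x p &
             forall e' : edge G, val e' \in path_edges x p -> c e' = c e -> e' = e)
          (conflict_free c x p).
Proof.
apply: (iffP existsP) => [[i /cards1P[e /setP eP]]|[e ep e_uniq]].
  have := eP e; rewrite !inE eqxx => /andP[ep /eqP ce]; exists e => // e' e'p ce'.
  by have := eP e'; rewrite !inE e'p ce' ce eqxx => /esym/eqP.
exists (c e); apply/cards1P; exists e; apply/setP => e'; rewrite !inE.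
apply/andP/eqP => [[e'p /eqP]|->]; [exact: e_uniq | by rewrite ep eqxx].
Qed.

End Edges.

(** * Acyclicity and uniqueness of paths from a height function *)

Section Heights.
Variables (G : sgraph) (h : G -> nat).
(* Each vertex has at most one neighbour that is not strictly higher, as in a
   forest with heights measured from the roots. *)
Hypothesis hP : forall x y z : G,
  adj x y -> adj x z -> h y <= h x -> h z <= h x -> y = z.

(** A highest vertex of a cycle of length at least three would have two distinct neighbours on the
    cycle, neither of them strictly higher. *)
Lemma height_acyclic : acyclic G.
Proof.
move=> s; case: s => // x0 s0; set s := x0 :: s0 => /andP[cs us].
have [x xs xmax] : exists2 x, x \in s & {in s, forall y, h y <= h x}.
  have s0P : x0 \in s by rewrite inE eqxx.
  case: (@arg_maxnP G x0 (mem s) h s0P) => x xs xmax.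
  by exists x => // y ys; apply: xmax.
have [i p rot_s] := rot_to xs; rewrite leqNgt; apply/negP => sz_s.
have mem_p y : y \in x :: p -> h y <= h x.
  by rewrite -rot_s mem_rot; apply: xmax.
have: cycle adj (x :: p) by rewrite -rot_s rot_cycle.
have: uniq (x :: p) by rewrite -rot_s rot_uniq.
have: 2 < size (x :: p) by rewrite -rot_s size_rot.
case/lastP: p mem_p {rot_s} => // p z; case: p => // y p mem_p _.
rewrite /= rcons_path last_rcons => /and3P[_ yp _] /and3P[xy _ zx].
move: yp; rewrite mem_rcons inE negb_or => /andP[/eqP yz _]; apply: yz.
apply: (hP xy); first by rewrite adj_sym.
  by apply: mem_p; rewrite !inE eqxx orbT.
by apply: mem_p; rewrite !inE mem_rcons inE eqxx !orbT.
Qed.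

(** After an ascent, the vertex just left is the only neighbour that is not higher, and a path
    cannot return to it. So a path that starts upwards keeps climbing. *)
Lemma height_lt_last (x y : G) (p : seq G) :
  path adj x (y :: p) -> uniq (x :: y :: p) -> h x < h y -> h x < h (last y p).
Proof.
elim: p x y => //= z p IHp x y /and3P[xy yz zp].
rewrite !inE !negb_or => /and3P[/and3P[_ xz _] yzp uzp] lt_xy.
apply: (ltn_trans lt_xy); apply: IHp => //=; first by rewrite yz.
  by rewrite inE negb_or yzp.
rewrite ltnNge; apply: contraNN xz => le_zy.
by apply/eqP/(@hP y) => //; [rewrite adj_sym | apply: ltnW].
Qed.

Lemma is_path_rev (x y : G) (p : seq G) :
  is_path x y p -> is_path y x (rev (belast x p)).
Proof.
case/and3P=> xp /eqP def_y up; apply/and3P; split.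
- by rewrite -def_y rev_path (eq_path (e' := adj)) // => a b; rewrite /= adj_sym.
- by rewrite -def_y; case: p {xp def_y up} => //= z p; rewrite rev_cons last_rcons.
by rewrite -def_y -rev_rcons -lastI rev_uniq.
Qed.

(** Read both paths from the higher endpoint, reversing them if needed. By [height_lt_last] the
    first step cannot ascend, so [hP] forces both paths to take the same one; induction handles the
    rest. *)
Lemma height_path_unique (x y : G) (p q : seq G) :
  is_path x y p -> is_path x y q -> p = q.
Proof.
move: {2}(size p) (leqnn (size p)) => n; elim: n => [|n IHn] in x y p q *.
  case: p => // _ /and3P[_ /eqP /= -> _]; case: q => //= z q /and3P[_ /eqP <- /=].
  by rewrite mem_last.
suff down x' y' p' q' : h y' <= h x' -> size p' <= n.+1 ->
    is_path x' y' p' -> is_path x' y' q' -> p' = q'.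
  move=> sz_p xp xq; case: (leqP (h y) (h x)) => [|/ltnW] le_h; first exact: down xq.
  have := down _ _ _ _ le_h _ (is_path_rev xp) (is_path_rev xq).
  rewrite size_rev size_belast => /(_ sz_p)/(congr1 rev); rewrite !revK => eq_b.
  have: x :: p = x :: q.
    case/and3P: xp xq => _ /eqP def_y _ /and3P[_ /eqP def_y' _].
    by rewrite (lastI x p) (lastI x q) eq_b def_y def_y'.
  by case.
move=> le_h sz xp xq.
have first_step z r : is_path x' y' (z :: r) -> h z <= h x'.
  case/and3P=> path_r /eqP def_y uniq_r; rewrite leqNgt; apply/negP => lt_xz.
  have := height_lt_last path_r uniq_r lt_xz.
  by rewrite /= in def_y; rewrite def_y ltnNge le_h.
case: p' q' sz xp xq => [|z p'] [|z' q'] //= sz xp xq.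
- by case/and3P: xp xq => _ /= /eqP <- _ /and3P[_ /eqP /= <-]; rewrite mem_last.
- by case/and3P: xq xp => _ /= /eqP <- _ /and3P[_ /eqP /= <-]; rewrite mem_last.
have [zx zx'] := (first_step _ _ xp, first_step _ _ xq).
case/and3P: xp xq => /= /andP[xz zp] def_y /andP[_ uzp].
case/and3P=> /= /andP[xz' zq] def_y' /andP[_ uzq].
have eq_z := hP xz xz' zx zx'; rewrite -{z' xz' zx'}eq_z in zq def_y' uzq *.
by congr (_ :: _); apply: (IHn z y') => //; apply/and3P.
Qed.

End Heights.

(** * Pulling colorings back along an injective homomorphism *)

Section Embedding.
Variables (G H : sgraph) (h : G -> H).
Hypotheses (h_inj : injective h) (h_adj : {homo h : x y / adj x y}).

Lemma path_edges_map (x : G) (p : seq G) :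
  path_edges (h x) (map h p) = [seq h @: (e : {set G}) | e : {set G} <- path_edges x p].
Proof. by elim: p x => //= y p IHp x; rewrite -IHp imsetU1 imset_set1. Qed.

Lemma is_path_map (x y : G) (p : seq G) :
  is_path x y p -> is_path (h x) (h y) (map h p).
Proof.
case/and3P=> xp /eqP <- up; rewrite /is_path last_map eqxx -map_cons.
by rewrite map_inj_uniq // up andbT (homo_path h_adj xp).
Qed.

Lemma imset_edges (e : edge G) : h @: val e \in edges H.
Proof.
case/edgesP: (valP e) => x [y [xy ->]].
by rewrite imsetU1 imset_set1 adj_edge // h_adj.
Qed.

(** A path of [G] maps to a path of [H], and [h] is injective on edges, so a uniquely colored edge
    pulls back. Colors are plain numbers on all vertex sets, which lets one coloring serve both a
    graph and its components. *)
Lemma cfc_le_embedding (m : nat) (c : {set H} -> nat) :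
    {in edges H, forall e, c e < m} ->
    (forall (x y : H) (p : seq H), x != y -> is_path x y p ->
       exists2 e, e \in path_edges x p &
         {in path_edges x p, forall e', c e' = c e -> e' = e}) ->
  cfc G <= m.
Proof.
move=> c_lt cP; rewrite /cfc; case: ex_minnP => j _; apply; apply/implyP.
case/andP=> _ /forallP Gconn.
apply/existsP; exists [ffun e => Ordinal (c_lt _ (imset_edges e))].
apply/forallP => x; apply/forallP => y; apply/implyP => neq_xy.
have /forallP/(_ y)/connectP[p0 p0P def_y] := Gconn x.
case/shortenP: p0P def_y => p xp up _ def_y.
have pP : is_path x y p by rewrite /is_path xp up def_y eqxx.
apply/cf_linkedP; exists p; split=> //; apply/conflict_freeP.
have neq_h : h x != h y by rewrite (inj_eq h_inj).
have [e0] := cP _ _ _ neq_h (is_path_map pP).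
rewrite path_edges_map => /mapP[e ep ->{e0}] e_uniq.
exists (Sub e (path_edges_sub xp ep)) => // e' e'p.
rewrite !ffunE => /(congr1 val) /= eq_c; apply: val_inj => /=.
by apply: (imset_inj h_inj); apply: e_uniq => //; apply: map_f.
Qed.

End Embedding.

(* Only upper constraints on the edges, so that the notion survives deletions. *)
Definition double_star (G : sgraph) (u v w : G) : Prop :=
  [/\ u != v,
      forall x y : G, adj x y -> (x \in [:: u; v]) != (y \in [:: u; v]) &
      forall x : G, adj x u -> adj x v -> x = w].

Lemma double_star_sym (G : sgraph) (u v w : G) :
  double_star u v w -> double_star v u w.
Proof.
case=> uv bip mid; split=> [|x y /bip|x xv xu]; first by rewrite eq_sym.
  by rewrite !inE ![(_ == v) || _]orbC.
exact: mid.
Qed.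

Lemma double_star_del_edge (G : sgraph) (e : {set G}) (u v w : G) :
  double_star u v w -> @double_star (del_edge e) u v w.
Proof.
case=> uv bip mid; split=> // [x y /andP[/bip]|x /andP[xu _] /andP[xv _]] //.
exact: mid.
Qed.

(** * Structure and coloring of double stars *)

Section DoubleStar.
Variables (G : sgraph) (u v w : G).
Hypothesis Guvw : double_star u v w.

(** The depth when the tree is rooted at the shared leaf [w]. *)
Definition dheight (x : G) : nat :=
  if x == w then 0 else if x \in [:: u; v] then 1 else 2.

(** All neighbours of [w] are higher; a centre other than [w] can only descend to [w]; any other
    vertex has only centres as neighbours, and being adjacent to both would make it [w]. *)
Lemma dheightP (x y z : G) : adj x y -> adj x z ->
  dheight y <= dheight x -> dheight z <= dheight x -> y = z.
Proof.
case: Guvw => uv bip mid xy xz; rewrite /dheight.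
have [xyb xzb] := (bip _ _ xy, bip _ _ xz).
case: (eqVneq x w) => [xw|xw].
  case: (eqVneq y w) => [->|_]; last by case: ifP.
  by case: (eqVneq z w) => [->|_]; last by case: ifP.
move: xyb xzb; case xuv: (x \in _); case yuv: (y \in _) => // _;
  case zuv: (z \in _) => // _.
  by case: (eqVneq y w) => // ->; case: (eqVneq z w).
move=> _ _; move: yuv zuv; rewrite !inE.
case/orP=> /eqP yE /orP[] /eqP zE; subst => //; case/eqP: xw; exact: mid.
Qed.

Lemma double_star_edge (x y : G) : adj x y ->
  exists c d, [/\ c \in [:: u; v], adj c d & [set x; y] = [set c; d]].
Proof.
case: Guvw => _ bip _ xy; move: (bip _ _ xy).
case xuv: (x \in _); case yuv: (y \in _) => // _; first by exists x, y.
by exists y, x; rewrite adj_sym setUC.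
Qed.

Lemma double_star_edges (e : {set G}) :
  e \in edges G -> e \in incident u \/ e \in incident v.
Proof.
move=> eG; case/edgesP: (eG) => x [y [/double_star_edge[c [d [cuv cd ->]]] def_e]].
move: eG; rewrite !inE def_e => ->.
by move: cuv; rewrite !inE => /orP[] /eqP ->; rewrite eqxx; [left | right].
Qed.

Lemma incident_disjoint (e : {set G}) : e \in incident u -> v \notin e.
Proof.
case: Guvw => uv bip _; rewrite incidentE => /imsetP[y]; rewrite inE => uy ->.
rewrite !inE negb_or eq_sym uv /=; move: (bip _ _ uy).
by rewrite !inE eqxx /=; apply: contraNN => /eqP <-; rewrite eqxx orbT.
Qed.

(** Centres occupy every other vertex of a path, so among the first four vertices two are distinct
    centres at distance two, and the vertex between them must be [w]. *)
Lemma long_path_middle (x y z t : G) (p : seq G) :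
  is_path x t [:: y, z & p] -> 0 < size p ->
  [set w; v] \in path_edges x [:: y, z & p].
Proof.
case: Guvw => uv bip mid; case: p => // s p.
case/and3P=> /and4P[xy yz zs _] _ upath _.
move: (bip _ _ xy) (bip _ _ yz) (bip _ _ zs).
have xz : x != z by move: upath; rewrite /= !inE !negb_or => /andP[/and3P[]].
have ys : y != s.
  by move: upath; rewrite /= !inE !negb_or => /and3P[_ /and3P[]].
have key a b : a != b -> a \in [:: u; v] -> b \in [:: u; v] ->
    forall m, adj a m -> adj m b ->
    m = w /\ ([set a; m] = [set w; v] \/ [set m; b] = [set w; v]).
  move=> ab au bu m am mb.
  move: ab au bu am mb; rewrite !inE => ab /orP[] /eqP aE /orP[] /eqP bE; subst a b;
    rewrite ?eqxx // in ab * => am mb.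
  - have -> : m = w by apply: mid; rewrite // adj_sym.
    by split=> //; right.
  - have -> : m = w by apply: mid; rewrite // adj_sym.
    by split=> //; left; rewrite setUC.
case xu: (x \in _); case yu: (y \in _); case zu: (z \in _); case su: (s \in _) => // _ _ _.
  by case: (key x z xz xu zu y xy yz) => _ [] <-; rewrite /= !inE eqxx ?orbT.
by case: (key y s ys yu su z yz zs) => _ [] <-; rewrite /= !inE eqxx ?orbT.
Qed.

(** If [wv] lies on the path, its color is unique. Otherwise the path has at most two edges; two
    edges must meet at a centre, since a middle vertex adjacent to both centres would be [w] and put
    [wv] on the path. *)
Lemma proper_unique_cf (c : {set G} -> nat) :
    {in incident u &, injective c} -> {in incident v &, injective c} ->
    {in edges G, forall e, c e = c [set w; v] -> e = [set w; v]} ->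
    forall (x y : G) (p : seq G), x != y -> is_path x y p ->
  exists2 e, e \in path_edges x p &
    {in path_edges x p, forall e', c e' = c e -> e' = e}.
Proof.
case: (Guvw) => uv bip mid cu cv cw x y p xy xp.
have [wvp|wvp] := boolP ([set w; v] \in path_edges x p).
  exists [set w; v] => // e /path_edges_sub eP; apply: cw.
  by case/and3P: xp => /eP.
case: p xp wvp => [|z [|t p]] xp wvp.
- by case/and3P: xp => _ /=; rewrite (negPf xy).
- by exists [set x; z] => [|e]; rewrite !inE // => /eqP.
have p0 : p = [::].
  by case: p xp wvp => // s p xp; rewrite (long_path_middle xp).
subst p; case/and3P: xp => /= /and3P[xz zt _] _.
rewrite !inE !negb_or => /and3P[/andP[_ xt] _ _].
exists [set x; z] => [|e]; rewrite ?inE ?eqxx // => /orP[] /eqP-> // eq_c.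
have [zuv|zuv] := boolP (z \in [:: u; v]).
  have [xzi zti] : [set x; z] \in incident z /\ [set z; t] \in incident z.
    by rewrite !inE !eqxx !adj_edge ?orbT.
  move: zuv; rewrite !inE => /orP[] /eqP zE; rewrite -> zE in *.
    exact: cu.
  exact: cv.
move: (bip _ _ xz) (bip _ _ zt); rewrite (negPf zuv).
rewrite eqbF_neg negbK eq_sym eqbF_neg negbK !inE.
case/orP=> /eqP xE /orP[] /eqP tE; subst x t; rewrite ?eqxx // in xt.
  have zw : z = w by apply: mid; rewrite // adj_sym.
  by rewrite zw /= !inE eqxx orbT in wvp.
have zw : z = w by apply: mid; rewrite // adj_sym.
by rewrite zw /= !inE [[set v; w]]setUC eqxx in wvp.
Qed.

Lemma double_star_coloring (m : nat) :
    adj w v -> #|incident u| < m -> #|incident v| <= m ->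
  exists2 c : {set G} -> nat, {in edges G, forall e, c e < m} &
    forall (x y : G) (p : seq G), x != y -> is_path x y p ->
    exists2 e, e \in path_edges x p &
      {in path_edges x p, forall e', c e' = c e -> e' = e}.
Proof.
move=> wv lt_u le_v; set f := [set w; v].
have fv : f \in incident v by rewrite !inE adj_edge // eqxx orbT.
have vu e : e \in incident v -> u \notin e.
  move=> ev; apply: contraL (ev) => ue.
  have /incident_disjoint : e \in incident u.
    by move: ev; rewrite !inE ue andbT => /andP[].
  by rewrite inE negb_and => ->; rewrite orbT.
have fu := vu _ fv.
pose s := f :: enum (incident v :\ f).
have sE e : (e \in s) = (e \in incident v).
  by rewrite inE mem_enum in_setD1; case: eqVneq => // ->; rewrite fv.
have sz_s : size s = #|incident v| by rewrite /= -cardE (cardsD1 f (incident v)) fv.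
(* The list [s] starts with [f], so [f] gets color 0. The successor keeps 0 away from the edges at
   [u], which is why the bound on [#|incident u|] is strict. *)
pose c (e : {set G}) := if u \in e then (index e (enum (incident u))).+1 else index e s.
exists c => [e eG|]; last apply: proper_unique_cf.
- rewrite /c; case: ifP => [ue|une].
    by apply: leq_trans lt_u; rewrite ltnS cardE index_mem mem_enum inE eG.
  case: (double_star_edges eG) => [|ev]; first by rewrite inE une andbF.
  by apply: leq_trans le_v; rewrite -sz_s index_mem sE.
- move=> e e'; rewrite /c => eu e'u; have [] := (eu, e'u).
  rewrite !inE => /andP[_ ->] /andP[_ ->] [].
  by apply: (@index_inj _ f (enum (incident u))); rewrite mem_enum.
- move=> e e' ev e'v; rewrite /c !ifN ?vu //.
  by apply: (@index_inj _ f s); rewrite sE.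
move=> e eG; rewrite /c (negPf fu) /s /= eqxx.
by case: ifP => // _; case: eqVneq.
Qed.

End DoubleStar.


(** * Too few colors: the lower bound *)

Section LowerBound.
Variables (G : sgraph) (u v w : G) (k : nat) (c : coloring G k).
Hypotheses (Guvw : double_star u v w) (wu : adj w u) (wv : adj w v).
Hypothesis cP : forall x y : G, x != y -> cf_linked c x y.

(** Paths are unique, so the path supplied by [cf_linked] is the given one. *)
Lemma cf_unique_path (x y : G) (p : seq G) : x != y -> is_path x y p ->
  exists2 e : edge G, val e \in path_edges x p &
    forall e' : edge G, val e' \in path_edges x p -> c e' = c e -> e' = e.
Proof.
move=> /cP/cf_linkedP[q [xq cfq]] xp; apply/conflict_freeP.
by rewrite (height_path_unique (dheightP Guvw) xp xq).
Qed.

(** Two distinct edges at [z] form a path of length two, which is conflict-free only if their colors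
    differ. *)
Lemma cf_edges_at (z : G) (e e' : edge G) :
  z \in val e -> z \in val e' -> c e = c e' -> e = e'.
Proof.
move=> ze ze' eq_c.
have at_z (f : edge G) : z \in val f -> val f \in incident z.
  by rewrite inE (valP f).
move: (at_z _ ze) (at_z _ ze'); rewrite !incidentE.
case/imsetP=> x; rewrite inE => zx def_e; case/imsetP=> y; rewrite inE => zy def_e'.
case: (eqVneq x y) => [xy|xy]; first by apply: val_inj; rewrite def_e def_e' xy.
have xp : is_path x y [:: z; y].
  apply/and3P; split; rewrite /= ?eqxx // ?[adj x z]adj_sym ?zx ?zy //.
  rewrite !inE negb_or xy !andbT; apply/andP; split.
    by apply: contraTneq zx => ->; rewrite adj_irr.
  by apply: contraTneq zy => ->; rewrite adj_irr.
have [f fp f_uniq] := cf_unique_path xy xp.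
have ep : val e \in path_edges x [:: z; y] by rewrite /= !inE def_e setUC eqxx.
have e'p : val e' \in path_edges x [:: z; y] by rewrite /= !inE def_e' eqxx orbT.
move: fp; rewrite /= !inE setUC -def_e -def_e' !val_eqE => /orP[] /eqP def_f.
  by symmetry; rewrite -def_f; apply: f_uniq => //; rewrite def_f.
by rewrite -def_f; apply: f_uniq => //; rewrite def_f.
Qed.

(** By [cf_edges_at] the coloring is injective on the edges at [z]; with at least [k] of them, it
    hits every color by counting. *)
Lemma color_at (z : G) (i : 'I_k) : k <= #|incident z| ->
  exists x (zx : adj z x), c (Sub [set z; x] (adj_edge zx)) = i.
Proof.
move=> le_k; pose E := [set e : edge G | z \in val e].
have card_E : #|incident z| = #|E|.
  rewrite -(card_imset E val_inj); congr #|pred_of_set _|; apply/setP => e.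
  apply/idP/imsetP => [|[f + ->]]; rewrite inE.
    by case/andP=> eG ze; exists (Sub e eG); rewrite ?inE.
  by rewrite inE (valP f).
have cE : c @: E = [set: 'I_k].
  apply/eqP; rewrite eqEcard subsetT cardsT card_ord card_in_imset -?card_E //.
  by move=> e e'; rewrite !inE; apply: cf_edges_at.
have /imsetP[e] : i \in c @: E by rewrite cE inE.
rewrite inE => ze ->; have : val e \in incident z by rewrite inE (valP e).
rewrite incidentE => /imsetP[x]; rewrite inE => zx def_e.
by exists x, zx; congr (c _); apply: val_inj.
Qed.

Lemma double_star_not_cf : k <= #|incident u| -> k <= #|incident v| -> False.
Proof.
move=> ku kv; have uw : adj u w by rewrite adj_sym.
have vw : adj v w by rewrite adj_sym.
pose euw : edge G := Sub [set u; w] (adj_edge uw).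
pose evw : edge G := Sub [set v; w] (adj_edge vw).
have disj (e e' : edge G) : u \in val e -> v \in val e' -> e = e' -> False.
  move=> ue ve' eq_e; have : val e \in incident u by rewrite inE (valP e).
  by move/(incident_disjoint Guvw); rewrite eq_e ve'.
have neq_c : c euw <> c evw.
  move/(@cf_edges_at w); rewrite !inE !eqxx !orbT => /(_ isT isT).
  by apply: disj; rewrite !inE eqxx.
have [x [ux c_ux]] := color_at (c evw) ku.
have [y [vy c_vy]] := color_at (c euw) kv.
set eux := Sub _ _ in c_ux; set evy := Sub _ _ in c_vy.
have xw : x != w.
  apply/eqP => xw; apply: neq_c; rewrite -c_ux; congr (c _).
  by apply: val_inj; rewrite /= xw.
have yw : y != w.
  apply/eqP => yw; apply: neq_c; rewrite -c_vy; congr (c _).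
  by apply: val_inj; rewrite /= yw.
case: Guvw => uv bip mid.
(* Otherwise [x] would be adjacent to both centres, hence equal to [w]. *)
have xy : x != y.
  by apply: contraNneq xw => xy; apply/eqP/mid; rewrite adj_sym // xy.
have neq_centre z s : adj z s -> z \in [:: u; v] -> (u != s) && (v != s).
  move/bip; rewrite !inE => + zuv; rewrite zuv.
  by rewrite ![s == _]eq_sym -negb_or; case: (_ || _).
have [/andP[ux' vx'] /andP[uy' vy']] :
    (u != x) && (v != x) /\ (u != y) && (v != y).
  by split; [apply: (neq_centre _ _ ux) | apply: (neq_centre _ _ vy)]; rewrite !inE eqxx ?orbT.
have /andP[uw' vw'] : (u != w) && (v != w).
  by apply: (neq_centre _ _ uw); rewrite !inE eqxx.
have xp : is_path x y [:: u; w; v; y].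
  apply/and3P; split; rewrite /= ?eqxx // ?[adj x u]adj_sym ?ux ?uw ?wv ?vy //.
  rewrite !inE !negb_or ![x == _]eq_sym ux' vx' [w == x]eq_sym xw [y == x]eq_sym xy.
  by rewrite uw' uv uy' [w == v]eq_sym vw' [w == y]eq_sym yw vy'.
have [e ep e_uniq] := cf_unique_path xy xp.
have in_path : [/\ val eux \in path_edges x [:: u; w; v; y],
    val euw \in path_edges x [:: u; w; v; y],
    val evw \in path_edges x [:: u; w; v; y] &
    val evy \in path_edges x [:: u; w; v; y]].
  by rewrite /= !inE [[set w; v]]setUC [[set x; u]]setUC !eqxx !orbT.
have [p1 p2 p3 p4] := in_path.
have [uux uuw vvw vvy] : [/\ u \in val eux, u \in val euw, v \in val evw & v \in val evy].
  by rewrite !inE !eqxx.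
(* Whichever of the four edges is the uniquely colored one, it has a partner of the same color at
   the other centre: [eux] with [evw], [euw] with [evy]. *)
move: ep; rewrite /= !inE [[set w; v]]setUC [[set x; u]]setUC.
case/or4P=> /eqP def_e.
- have eE : e = eux by apply: val_inj.
  by apply: (disj _ _ uux vvw); rewrite -eE -(e_uniq evw) ?eE.
- have eE : e = euw by apply: val_inj.
  by apply: (disj _ _ uuw vvy); rewrite -eE -(e_uniq evy) ?eE.
- have eE : e = evw by apply: val_inj.
  by apply: (disj _ _ uux vvw); rewrite -eE -(e_uniq eux) ?eE.
have eE : e = evy by apply: val_inj.
by apply: (disj _ _ uuw vvy); rewrite -eE -(e_uniq euw) ?eE.
Qed.

End LowerBound.

(** * Criticality of double stars *)

(** Deleting an edge at [u] leaves fewer than [n] edges there, freeing a color for [wv], which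
    survives because [e] avoids [v]. The coloring then restricts to the component along [val]. *)
Lemma cfc_induced_del_edge (G : sgraph) (u v w : G) (n : nat) (e : {set G})
    (C : {set del_edge e}) :
    double_star u v w -> adj w v -> e \in incident u ->
    #|incident u| <= n -> #|incident v| <= n ->
  cfc (induced C) <= n.
Proof.
move=> Guvw wv eu le_u le_v.
have sub_inc (x : G) : @incident (del_edge e) x \subset incident x :\ e.
  apply/subsetP => f; rewrite !inE => /andP[/edgesP[y [z [/andP[yz yze] ->]]] ->].
  by rewrite yze adj_edge.
have Guvw' := @double_star_del_edge _ e _ _ _ Guvw.
have [|||c c_lt cP] := @double_star_coloring (del_edge e) u v w Guvw' n.
- rewrite /= /del_edge_adj wv; apply: contraTneq (incident_disjoint Guvw eu) => <-.
  by rewrite !inE eqxx orbT.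
- apply: leq_ltn_trans (subset_leq_card (sub_inc u)) _.
  by apply: leq_trans le_u; rewrite (cardsD1 e (incident u)) eu.
- apply: leq_trans (subset_leq_card (sub_inc v)) _.
  by apply: leq_trans le_v; apply: subset_leq_card; apply: subD1set.
exact: (@cfc_le_embedding (induced C) (del_edge e) val val_inj _ n c).
Qed.

Lemma double_star_critical (G : sgraph) (u v w : G) (n : nat) :
    connected G -> double_star u v w -> adj w u -> adj w v ->
    #|incident u| = n -> #|incident v| = n ->
  k_cfc_critical n.+1 G.
Proof.
move=> Gconn Guvw wu wv card_u card_v.
have cfcG : cfc G = n.+1.
  apply/eqP; rewrite eqn_leq; apply/andP; split.
    have [||c c_lt cP] := @double_star_coloring _ u v w Guvw n.+1 wv.
    - by rewrite card_u.
    - by rewrite card_v.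
    exact: (@cfc_le_embedding G G id (@inj_id _) _ n.+1 c).
  rewrite /cfc; case: ex_minnP => k; rewrite Gconn => /existsP[c cP] _.
  (* With at most [n] colors, each centre has at least as many edges as there are colors. *)
  rewrite ltnNge; apply/negP => le_k.
  apply: (@double_star_not_cf _ u v w k c); rewrite ?card_u ?card_v // => x y.
  by move/forallP/(_ x)/forallP/(_ y)/implyP: cP.
split=> //; split.
- by split=> //; apply: height_acyclic (dheightP Guvw).
- by apply/card_gt1P; exists u, v; case: Guvw.
move=> e /(double_star_edges Guvw) eP C _ _; rewrite cfcG ltnS; case: eP => eP.
  by apply: (cfc_induced_del_edge _ Guvw); rewrite ?card_u ?card_v.
by apply: (cfc_induced_del_edge _ (double_star_sym Guvw)); rewrite ?card_u ?card_v.
Qed.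

(* For [n = 1] the leaf may be [None], and the centre is then the other vertex. *)
Lemma star_centre (n : nat) (a : star n) : leaf a ->
  exists2 c : star n, a != c & forall x y : star n, adj x y = ((x == c) != (y == c)).
Proof.
case: a => [i|] la; first by exists None => // -[x|] [y|].
case/cards1P: la => c /setP cP.
have cE x : (x == c) = isSome x by have := cP x; rewrite !inE; case: x.
by exists c => [|x y]; rewrite ?cE //.
Qed.

(** * Two stars glued at a leaf form a double star *)

Section GlueStars.
Variables (n : nat) (a b c d : star n).
Hypotheses (ac : a != c) (db : d != b).
Hypothesis adjc : forall x y : star n, adj x y = ((x == c) != (y == c)).
Hypothesis adjd : forall x y : star n, adj x y = ((x == d) != (y == d)).

Let u : glue a b := inl c.
Let v : glue a b := inr (Sub d db).
Let w : glue a b := inl a.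

Let adj_ll (x y : star n) : @adj (glue a b) (inl x) (inl y) = ((x == c) != (y == c)).
Proof. exact: adjc. Qed.

Let adj_rr (x y : {y : star n | y != b}) :
  @adj (glue a b) (inr x) (inr y) = ((val x == d) != (val y == d)).
Proof. exact: adjd. Qed.

Let adj_lr (x : star n) (y : {y : star n | y != b}) :
  @adj (glue a b) (inl x) (inr y) = (x == a) && (val y == d).
Proof.
rewrite -[LHS]/((x == a) && @adj (star n) b (val y)) adjd [b == d]eq_sym (negPf db).
by case: (x == a); case: (_ == d).
Qed.

Lemma glue_adj_left : adj w u.
Proof. by rewrite adj_ll (negPf ac) eqxx. Qed.

Lemma glue_adj_right : adj w v.
Proof. by rewrite adj_lr !eqxx. Qed.

Lemma glue_connected : connected (glue a b).
Proof.
have csym : connect_sym (@adj (glue a b)).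
  by apply: sym_connect_sym; apply: adj_sym.
have to_w x : connect adj x w.
  rewrite csym; case: x => x.
    case: (eqVneq x c) => [->|xc]; first exact: connect1 glue_adj_left.
    apply: connect_trans (connect1 glue_adj_left) (connect1 _).
    by rewrite adj_ll eqxx (negPf xc).
  case: (eqVneq x (Sub d db)) => [->|xd]; first exact: connect1 glue_adj_right.
  apply: connect_trans (connect1 glue_adj_right) (connect1 _).
  by rewrite adj_rr eqxx; move: xd; rewrite -val_eqE /= => /negPf ->.
apply/andP; split; first by apply/card_gt0P; exists w.
apply/forallP => x; apply/forallP => y.
by apply: connect_trans (to_w x) _; rewrite csym.
Qed.

Lemma glue_double_star : double_star u v w.
Proof.
split=> //.
  have mem_l x : (inl x \in [:: u; v]) = (x == c) by rewrite !inE orbF.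
  have mem_r x : (inr x \in [:: u; v]) = (val x == d) by rewrite !inE.
  case=> x [] y; rewrite ?mem_l ?mem_r ?adj_ll ?adj_rr ?adj_lr //.
    by case/andP=> /eqP -> ->; rewrite (negPf ac).
  by rewrite adj_sym adj_lr => /andP[/eqP -> ->]; rewrite (negPf ac).
case=> x; first by rewrite adj_lr => _ /andP[/eqP ->].
by rewrite adj_sym adj_lr eq_sym (negPf ac).
Qed.

Lemma card_star_compl (x : star n) : #|[set~ x]| = n.
Proof. by rewrite cardsC1 card_option card_ord. Qed.

Lemma card_incident_left : #|incident u| = n.
Proof.
have inlI : injective (inl : star n -> glue a b) by move=> x y [].
suff N_u : [set y | adj u y] = inl @: [set~ c].
  by rewrite card_incident N_u card_imset ?card_star_compl.
apply/setP => -[] x; rewrite inE.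
  by rewrite adj_ll eqxx mem_imset // !inE.
by rewrite adj_lr eq_sym (negPf ac); apply/esym/imsetP => -[].
Qed.

Lemma card_incident_right : #|incident v| = n.
Proof.
(* The embedding of the second star into the glued graph: [insub] fails exactly at [b], which goes
   to the merged vertex [inl a]. *)
pose f (y : star n) : glue a b := if insub y is Some z then inr z else inl a.
have f_val z : f (val z) = inr z by rewrite /f valK.
have f_inj : injective f.
  move=> x y; rewrite /f; case: insubP => [x' _ <-|]; case: insubP => [y' _ <-|] //.
    by move=> [->].
  by rewrite !negbK => /eqP -> /eqP ->.
suff N_v : [set y | adj v y] = f @: [set~ d].
  by rewrite card_incident N_v card_imset ?card_star_compl.
apply/setP => -[] x; rewrite inE; last first.
  by rewrite adj_rr eqxx -f_val mem_imset // !inE.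
rewrite adj_sym adj_lr eqxx andbT; apply/eqP/imsetP => [->|[y _]].
  by exists b; rewrite ?inE 1?eq_sym // /f insubF ?eqxx.
by rewrite /f; case: insubP => // _ [].
Qed.

End GlueStars.

Theorem theorem4p3 (k : nat) (hk : 2 <= k) (a b : star k.-1)
    (ha : leaf a) (hb : leaf b) :
  k_cfc_critical k (glue a b).
Proof.
have [c ac adjc] := star_centre ha; have [d bd adjd] := star_centre hb.
have db : d != b by rewrite eq_sym.
(* Only the color count is rewritten as [k.-1.+1]; the stars keep [k.-1] edges each. *)
rewrite -[in X in k_cfc_critical X](prednK (ltnW hk)).
apply: (double_star_critical (glue_connected ac db adjc adjd)
          (glue_double_star ac db adjc adjd)).
- exact: glue_adj_left ac adjc.
- exact: glue_adj_right db adjd.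
- exact: card_incident_left ac db adjc adjd.
exact: card_incident_right db adjd.
Qed.
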